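(* For every integer $s \geq 3$ there exists a constant $C>0$, depending only on $s$, such that for every prime $p$ and every non-empty set $A \subseteq \mathbb{F}_p$, one has \[ J_s(A) \leq C\left( \frac{|A|^{2s-1}}{p} + |A|^2 p^{s-2} (\log |A|)^{2s} \right). \]
   Context: For a prime $p$, a set $A \subseteq \mathbb{F}_p$ and $s \in \mathbb{N}$, $J_s(A)$ denotes the number of $2s$-tuples $(x_1,\dots,x_{2s}) \in A^{2s}$ such that \[ \sum_{i=1}^{s}(x_i - x_{i+s}) = 0 \quad\text{and}\quad \sum_{i=1}^{s}(x_i^2 - x_{i+s}^2) = 0 \quad \text{in } \mathbb{F}_p. \]
   Formalization: The formal theorem assumes |A| ≥ 2 instead of A non-empty: for |A| = 1 one has J_s(A) = 1 while log|A| = 0, so the bound would read 1 ≤ C/p for every prime p, which no constant C satisfies. *)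

(* Defs.v *)
From mathcomp Require Import all_boot all_order all_algebra.
From mathcomp Require Import reals exp.

Set Implicit Arguments.
Unset Strict Implicit.
Unset Printing Implicit Defensive.

Import GRing.Theory.
Local Open Scope ring_scope.

(* [J s A] is J_s(A).  A 2s-tuple is a function on 'I_(s + s): x_i is the value
   at [lshift s i] and x_(i+s) the value at [rshift s i], for i : 'I_s.
   'F_p is the field with p elements only when p is prime. *)
Definition J (p s : nat) (A : {set 'F_p}) : nat :=
  #|[set x : {ffun 'I_(s + s) -> 'F_p} |
      [&& [forall k, x k \in A],
          \sum_(i < s) (x (lshift s i) - x (rshift s i)) == 0
        & \sum_(i < s) (x (lshift s i) ^+ 2 - x (rshift s i) ^+ 2) == 0]]|.

(* Main.v *)
Require Import Defs.
From mathcomp Require Import all_boot all_order all_algebra.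
From mathcomp Require Import reals exp.
From mathcomp Require Import ring lra zify.

Set Implicit Arguments.
Unset Strict Implicit.
Unset Printing Implicit Defensive.

Import Order.TTheory GRing.Theory Num.Theory.
Local Open Scope ring_scope.

(** Let r_n(v) be the number of ways to write a vector v of the plane F x F as
    a sum of n points (x, x^2) of the parabola with x in A, and let E_n be the
    sum of r_n(v)^2.  Matching the first half of a 2s-tuple with the second
    gives J_s(A) = E_s ([J_energy]).  Write N = |A| and q = |F|.

    The heart of the proof is that, when 2 is invertible, averaging over the
    translates of a parabola is close to averaging over the whole plane: if
    Tg(v) is the sum of g over the points v - (x, x^2), and G the total mass of
    g >= 0, then
      sum_v (Tg(v) - G/q)^2 <= q * sum_v g(v)^2   ([parab_avg_variance]).
    This holds because a difference (a, b) with a != 0 is realised by exactly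
    one pair of points of the parabola, and one with a = 0, b != 0 by none, so
    that the off-diagonal part of |Tg|^2 contributes at most G^2.

    As r_(n+1) is the sum of r_n over a subset of such a translated parabola,
    r_(n+1) <= T r_n pointwise.  Hence E_(n+1) <= sum_v r_(n+1)(v) T r_n(v);
    replacing T r_n by its mean N^n/q and estimating the deviation by the
    inequality above yields
      E_(n+1) <= 2 N^(2n+1)/q + q E_n   ([energyS]).
    Starting from E_2 <= 2 N^2, which says that a vector is a sum of two points
    of the parabola in at most two ways, induction gives
      E_s <= 4^s (N^(2s-1)/q + N^2 q^(s-2))   ([energy_le]).
    As N >= 2, the factor (ln N)^(2s) is at least the positive constant
    (ln 2)^(2s), which the constant C takes care of.  In characteristic 2 one
    has N <= p = 2, and E_s <= N^(2s) suffices. *)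

(** * Concatenation of finite functions *)

Definition ffun_cat (T : finType) (m n : nat)
    (yz : {ffun 'I_m -> T} * {ffun 'I_n -> T}) : {ffun 'I_(m + n) -> T} :=
  [ffun k => match split k with inl i => yz.1 i | inr j => yz.2 j end].

Lemma ffun_cat_lshift (T : finType) m n (y : {ffun 'I_m -> T})
  (z : {ffun 'I_n -> T}) i : ffun_cat (y, z) (lshift n i) = y i.
Proof. by rewrite ffunE (unsplitK (inl i)). Qed.

Lemma ffun_cat_rshift (T : finType) m n (y : {ffun 'I_m -> T})
  (z : {ffun 'I_n -> T}) j : ffun_cat (y, z) (rshift m j) = z j.
Proof. by rewrite ffunE (unsplitK (inr j)). Qed.

Definition ffun_catE := (ffun_cat_lshift, ffun_cat_rshift).

Lemma ffun_cat_bij (T : finType) m n : bijective (@ffun_cat T m n).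
Proof.
exists (fun f : {ffun 'I_(m + n) -> T} =>
          ([ffun i => f (lshift n i)], [ffun j => f (rshift m j)])).
  by move=> [y z]; congr pair; apply/ffunP => i; rewrite ffunE ffun_catE.
by move=> f; apply/ffunP => k; rewrite ffunE; case: split_ordP => j -> /=;
  rewrite ffunE.
Qed.

Lemma ffun_cat_forall (T : finType) m n (P : pred T) (y : {ffun 'I_m -> T})
    (z : {ffun 'I_n -> T}) :
  [forall k, P (ffun_cat (y, z) k)] = [forall i, P (y i)] && [forall j, P (z j)].
Proof.
apply/forallP/andP => [H | [/forallP Hy /forallP Hz] k].
  split; apply/forallP => i.
    by have := H (lshift n i); rewrite ffun_catE.
  by have := H (rshift m i); rewrite ffun_catE.
by case: (split_ordP k) => j ->; rewrite ffun_catE.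
Qed.

(** * Representations as sums of points of the parabola *)

Lemma sum_eq_muln (T : finType) (a : T) (f : T -> nat) :
  (\sum_w (a == w) * f w = f a)%N.
Proof.
rewrite (bigD1 a) //= eqxx mul1n big1 ?addn0 // => w.
by rewrite eq_sym => /negPf ->.
Qed.

Section Representations.
Variable F : finFieldType.
Implicit Types (A : {set F}) (v w : F * F).

Definition parab (x : F) : F * F := (x, x ^+ 2).

Lemma sum_parab (I : finType) (y : I -> F) :
  \sum_i parab (y i) = (\sum_i y i, \sum_i y i ^+ 2).
Proof. by elim/big_rec3: _ => // i a b c _ ->. Qed.

Definition reps A (n : nat) v : nat :=
  #|[set y : {ffun 'I_n -> F} |
      [forall i, y i \in A] && (\sum_i parab (y i) == v)]|.

Lemma repsE A n v :
  (reps A n v = \sum_(y : {ffun 'I_n -> F} | [forall i, y i \in A])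
                 ((\sum_i parab (y i))%R == v))%N.
Proof.
rewrite /reps -sum1_card; under eq_bigl do rewrite inE.
by rewrite big_mkcondr; apply: eq_bigr => y _; case: (_ == v).
Qed.

Lemma sum_reps A n : (\sum_v reps A n v = #|A| ^ n)%N.
Proof.
under eq_bigr do rewrite repsE.
rewrite exchange_big /= -[RHS](congr1 (expn #|A|) (card_ord n)).
rewrite -card_ffun_on -sum1_card.
apply: eq_big => [y | y _].
  by apply/forallP/ffun_onP.
by under eq_bigr do rewrite -[nat_of_bool _]muln1; rewrite sum_eq_muln.
Qed.

(** Splitting a tuple into its first [m] and last [n] entries turns the
    representation function into a convolution. *)
Lemma repsD A m n v :
  (reps A (m + n) v = \sum_w reps A m w * reps A n (v - w)%R)%N.
Proof.
rewrite repsE (reindex (@ffun_cat F m n)) /=; last exact/onW_bij/ffun_cat_bij.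
under [RHS]eq_bigr do rewrite !repsE big_distrlr /=.
rewrite exchange_big /=; under [RHS]eq_bigr do rewrite exchange_big /=.
rewrite pair_big; apply: eq_big => [[y z] | [y z] _] /=.
  by rewrite (ffun_cat_forall (mem A)).
rewrite sum_eq_muln.
rewrite big_split_ord /=; congr nat_of_bool.
under eq_bigr do rewrite ffun_cat_lshift.
under [X in _ + X == v]eq_bigr do rewrite ffun_cat_rshift.
by apply/eqP/eqP => [<- | ->]; rewrite addrC ?addKr ?addrNK.
Qed.

Lemma reps1 A w : (reps A 1 w = \sum_(x in A) (parab x == w))%N.
Proof.
rewrite repsE (reindex (fun x => [ffun=> x] : {ffun 'I_1 -> F})) /=; last first.
  exists (fun y : {ffun 'I_1 -> F} => y ord0) => [x _ | y _]; first by rewrite ffunE.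
  by apply/ffunP => i; rewrite ffunE (ord1 i).
apply: eq_big => [x | x _]; last by rewrite big_ord1 ffunE.
by apply/forallP/idP => [/(_ ord0) | Ax i]; rewrite ffunE.
Qed.

Lemma repsS A n v : (reps A n.+1 v = \sum_(x in A) reps A n (v - parab x)%R)%N.
Proof.
rewrite -add1n repsD; under eq_bigr do rewrite reps1 big_distrl.
rewrite exchange_big; apply: eq_bigr => x _ /=.
by rewrite sum_eq_muln.
Qed.

(** If [v] has the representations {a, v.1 - a} and {x, v.1 - x}, then the
    difference of the two sums of squares factors as
    - 2 (x - a) (x - (v.1 - a)), which forces both to be the same unordered pair. *)
Lemma reps2_le2 A v : (2 : F) != 0 -> (reps A 2 v <= 2)%N.
Proof.
move=> two_neq0.
have -> : reps A 2 v = #|[set x in A | (v.1 - x \in A) &&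
                            (v.2 == x ^+ 2 + (v.1 - x) ^+ 2)]|.
  rewrite repsS -sum1_card; under [RHS]eq_bigl do rewrite inE.
  rewrite [RHS]big_mkcondr; apply: eq_bigr => x _; rewrite reps1.
  have [Ax | nAx] /= := boolP (v.1 - x \in A); last first.
    rewrite big1 // => y Ay; apply/eqP; rewrite eqb0.
    by apply: contraNneq nAx => /(congr1 fst) /= <-.
  rewrite (bigD1 (v.1 - x)) //= big1 => [|y /andP[_ /negPf yE]]; last first.
    by apply/eqP; rewrite eqb0; apply: contraFneq yE => /(congr1 fst) /= ->.
  rewrite addn0; have -> : (parab (v.1 - x) == v - parab x)
      = (v.2 == x ^+ 2 + (v.1 - x) ^+ 2).
    case: v {Ax} => a b; rewrite /parab xpair_eqE /= eqxx /=.
    by rewrite [LHS]eq_sym subr_eq addrC.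
  by case: ifP.
set S := [set _ in _ | _]; case: (set_0Vmem S) => [-> | [a aS]].
  by rewrite cards0.
apply: (@leq_trans #|[set a; v.1 - a]|); last first.
  by rewrite cards2; case: (_ == _).
apply/subset_leq_card/subsetP => x; move: aS; rewrite !inE.
move=> /and3P[_ _ /eqP aE] /and3P[_ _ /eqP].
rewrite aE => /eqP; rewrite -subr_eq0.
have -> : a ^+ 2 + (v.1 - a) ^+ 2 - (x ^+ 2 + (v.1 - x) ^+ 2)
   = - (2 * ((x - a) * (x - (v.1 - a)))) by ring.
by rewrite oppr_eq0 !mulf_eq0 (negPf two_neq0) /= !subr_eq0.
Qed.

End Representations.

(** * Averages over translates of the parabola *)

Section SpreadingEstimate.
Variables (R : realFieldType) (F : finFieldType).
Hypothesis two_neq0 : (2 : F) != 0.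
Implicit Types (g : F * F -> R).

Lemma sum_shift g (w : F * F) : \sum_(v : F * F) g (v + w) = \sum_v g v.
Proof.
by rewrite [RHS](reindex_inj (addIr w)).
Qed.

(** In odd characteristic, each vector (a, b) with a != 0 is the difference of
    exactly one pair of points of the parabola: the pair x, y satisfies
    x - y = a and x + y = b / a. *)
Lemma sum_parab_diff g (w : F * F) : (forall v, 0 <= g v) ->
  \sum_(x : F) \sum_(y : F | x != y) g (w + (parab x - parab y)) <= \sum_v g v.
Proof.
move=> g_ge0.
rewrite pair_big_dep /=.
(* With x = a + b and y = b the difference is (a, a (a + 2 b)), and the
   condition that x and y differ becomes a != 0. *)
pose h (ab : F * F) := (ab.1 + ab.2, ab.2).
have hI : bijective h.
  by exists (fun ab : F * F => (ab.1 - ab.2, ab.2)) => -[a b] /=; rewrite /h /= ?addrK ?subrK.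
rewrite (reindex h) /=; last exact: onW_bij.
rewrite -(sum_shift g w).
pose k (ab : F * F) : F * F := (ab.1, ab.1 * (ab.1 + 2 * ab.2)).
have kI : {in [pred ab : F * F | ab.1 != 0] &, injective k}.
  move=> [a b] [c d] /= a0 _ [<-] /(mulfI a0) /addrI /(mulfI two_neq0) ->.
  by [].
rewrite (eq_bigr (fun ab => g (k ab + w))); last first.
  move=> [a b] _; congr g; rewrite addrC; congr (_ + _).
  by rewrite /parab /k /=; congr pair => /=; ring.
rewrite (eq_bigl [pred ab : F * F | ab.1 != 0]); last first.
  by move=> [a b] /=; rewrite -subr_eq0 addrK.
rewrite -(big_imset (fun v : F * F => g (v + w)) kI) /=.
by rewrite [leRHS](bigID (mem (k @: [pred ab : F * F | ab.1 != 0]))) /= lerDl sumr_ge0.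
Qed.

(** The mean of the averages over all translates is [G / q], so the left-hand
    side is the second moment minus [G ^+ 2].  In the second moment the
    coinciding points of the parabola contribute [q] times the square norm of
    [g], and by [sum_parab_diff] the distinct ones at most [G ^+ 2]. *)
Lemma parab_avg_variance g : (forall v, 0 <= g v) ->
  \sum_(v : F * F) (\sum_(x : F) g (v - parab x) - (\sum_v g v) / #|F|%:R) ^+ 2
    <= #|F|%:R * \sum_v g v ^+ 2.
Proof.
move=> g_ge0; set G := \sum_v g v; set q : R := #|F|%:R.
have q_gt0 : 0 < q by rewrite ltr0n; apply/card_gt0P; exists 0.
have sumT : \sum_(v : F * F) \sum_(x : F) g (v - parab x) = q * G.
  rewrite exchange_big /= (eq_bigr (fun _ => G)); last by move=> x _; rewrite sum_shift.
  by rewrite sumr_const -mulr_natl.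
have sumT2 : \sum_(v : F * F) (\sum_(x : F) g (v - parab x)) ^+ 2
    <= q * (\sum_v g v ^+ 2) + G ^+ 2.
  have -> : \sum_(v : F * F) (\sum_(x : F) g (v - parab x)) ^+ 2
     = \sum_(w : F * F) g w * \sum_(x : F) \sum_(y : F) g (w + (parab x - parab y)).
    under eq_bigr do rewrite expr2 big_distrlr.
    rewrite exchange_big [RHS](eq_bigr (fun w : F * F => \sum_(x : F) g w *
      \sum_(y : F) g (w + (parab x - parab y)))); last first.
      by move=> w _; rewrite mulr_sumr.
    rewrite [RHS]exchange_big; apply: eq_bigr => x _ /=.
    rewrite (reindex_inj (addIr (parab x))) /=; apply: eq_bigr => w _.
    by rewrite mulr_sumr; apply: eq_bigr => y _; rewrite addrK addrA.
  have -> : q * (\sum_v g v ^+ 2) + G ^+ 2 = \sum_w g w * (q * g w + G).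
    rewrite expr2 {1}/G mulr_suml mulr_sumr -big_split; apply: eq_bigr => w _ /=.
    by ring.
  apply: ler_sum => w _; apply: ler_wpM2l => //.
  apply: le_trans (lerD (lexx (q * g w)) (sum_parab_diff w g_ge0)).
  have -> : q * g w = \sum_(x : F) g w by rewrite sumr_const -mulr_natl.
  rewrite -big_split; apply: ler_sum => x _ /=.
  by rewrite (bigD1 x) //= subrr addr0; under eq_bigl do rewrite eq_sym.
have -> : \sum_(v : F * F) (\sum_(x : F) g (v - parab x) - G / q) ^+ 2
   = \sum_(v : F * F) (\sum_(x : F) g (v - parab x)) ^+ 2 - G ^+ 2.
  under eq_bigr do rewrite sqrrB.
  rewrite big_split sumrB /= sumr_const sumrMnl -mulr_suml sumT card_prod.
  rewrite -[X in _ + X = _]mulr_natl natrM -/q.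
  by field; rewrite gt_eqF.
by lra.
Qed.

End SpreadingEstimate.

(** * Growth of the energy *)

Section Energy.
Variables (R : realFieldType) (F : finFieldType).
Hypothesis two_neq0 : (2 : F) != 0.
Implicit Types (A : {set F}).

Definition energy A n : R := \sum_v (reps A n v)%:R ^+ 2.

(** One variable is allowed to leave [A] and to range over the whole parabola;
    then [parab_avg_variance] applies to the representation function. *)
Lemma energyS A n :
  energy A n.+1 <= 2 * (#|A|%:R ^+ (2 * n + 1) / #|F|%:R) + #|F|%:R * energy A n.
Proof.
set q : R := #|F|%:R.
pose g (v : F * F) : R := (reps A n v)%:R.
pose f (v : F * F) : R := (reps A n.+1 v)%:R.
have sumf m : \sum_v (reps A m v)%:R = #|A|%:R ^+ m :> R.
  by rewrite -natr_sum sum_reps natrX.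
have fT v : f v <= \sum_(x : F) g (v - parab x).
  rewrite /f repsS natr_sum [leRHS](bigID (mem A)) /= lerDl sumr_ge0 //.
have var := parab_avg_variance two_neq0 (fun v => ler0n R (reps A n v)).
rewrite sumf -/q in var.
pose D (v : F * F) := \sum_(x : F) g (v - parab x) - #|A|%:R ^+ n / q.
(* f^2 <= f (D + mean) and 2 f D <= f^2 + D^2: the extra f^2 is absorbed on the
   left, which is where the factor 2 on the main term comes from. *)
have pt v : f v ^+ 2 <= 2 * (#|A|%:R ^+ n / q * f v) + D v ^+ 2.
  have := sqr_ge0 (f v - D v); have f0 : 0 <= f v by [].
  have : f v * f v <= f v * (D v + #|A|%:R ^+ n / q).
    by apply: ler_wpM2l => //; rewrite /D subrK.
  by nra.
rewrite /energy; apply: le_trans (ler_sum _ (fun v _ => pt v)) _.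
rewrite big_split /= -!mulr_sumr sumf; apply: lerD => //.
by rewrite ler_pM2l // mulrAC -exprD addnS addnn -mul2n addn1.
Qed.

Lemma energy2 A : energy A 2 <= 2 * #|A|%:R ^+ 2.
Proof.
rewrite -(natrX R) -sum_reps natr_sum mulr_sumr; apply: ler_sum => v _.
by rewrite expr2 ler_wpM2r // ler_nat reps2_le2.
Qed.

(** Iterating [energyS] produces the cross term [N ^+ (2 * n + 3)]; it is below
    one of the two main terms, according to whether [N ^+ 2] exceeds [q]. *)
Lemma energy_le A n : (0 < #|A|)%N ->
  energy A n.+2 <= 4 ^+ n.+2 * (#|A|%:R ^+ (2 * n.+2 - 1) / #|F|%:R
                              + #|A|%:R ^+ 2 * #|F|%:R ^+ n).
Proof.
move=> A_gt0; set q : R := #|F|%:R; set N : R := #|A|%:R.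
have q_gt0 : 0 < q by rewrite ltr0n; apply/card_gt0P; exists 0.
have N_ge1 : 1 <= N by rewrite ler1n.
have N_gt0 : 0 < N by apply: lt_le_trans N_ge1.
elim: n => [|n IHn].
  have := energy2 A; rewrite -/N.
  have : 0 <= N ^+ (2 * 2 - 1) / q by rewrite divr_ge0 ?exprn_ge0 ?ltW.
  have : 0 <= N ^+ 2 by rewrite sqr_ge0.
  by nra.
have := energyS A n.+2; rewrite -/q -/N.
have -> : (2 * n.+2 + 1 = 2 * n.+3 - 1)%N by lia.
set X := N ^+ (2 * n.+3 - 1) / q; set Y := N ^+ 2 * q ^+ n.+1.
have X_ge0 : 0 <= X by rewrite divr_ge0 ?exprn_ge0 ?ltW.
have Y_ge0 : 0 <= Y by rewrite mulr_ge0 ?exprn_ge0 ?ltW.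
have mid : N ^+ (2 * n.+2 - 1) <= X + Y.
  have [qN | Nq] := leP q (N ^+ 2).
    rewrite -[leLHS]addr0 lerD // ler_pdivlMr //.
    have -> : (2 * n.+3 - 1 = (2 * n.+2 - 1) + 2)%N by lia.
    by rewrite exprD ler_wpM2l // exprn_ge0 // ltW.
  rewrite -[leLHS]add0r lerD //.
  have -> : (2 * n.+2 - 1 = 2 + (2 * n).+1)%N by lia.
  rewrite exprD ler_wpM2l ?sqr_ge0 //.
  apply: (@le_trans _ _ (N ^+ (2 * n.+1))).
    by apply: ler_weXn2l => //; rewrite mulnS.
  rewrite exprM; apply: lerXn2r; rewrite ?nnegrE ?sqr_ge0 ?ltW //.
have step : q * energy A n.+2 <= 4 ^+ n.+2 * (N ^+ (2 * n.+2 - 1) + Y).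
  have -> : 4 ^+ n.+2 * (N ^+ (2 * n.+2 - 1) + Y) =
    q * (4 ^+ n.+2 * (N ^+ (2 * n.+2 - 1) / q + N ^+ 2 * q ^+ n)).
    by rewrite /Y (exprS q); field; rewrite gt_eqF.
  by rewrite ler_pM2l.
have C_ge1 : 1 <= 4 ^+ n.+2 :> R by rewrite exprn_ege1 // ler1n.
rewrite [4 ^+ n.+3]exprS; set C := 4 ^+ n.+2 in step C_ge1 *.
have : C * (N ^+ (2 * n.+2 - 1) + Y) <= C * (X + Y + Y) by rewrite ler_pM2l ?lerD2r //; lra.
have : X + Y <= C * (X + Y) by rewrite ler_peMl // addr_ge0.
have : 0 <= C * X by rewrite mulr_ge0 //; lra.
by lra.
Qed.

End Energy.

(** * The bound for prime fields *)

Lemma J_energy (R : realFieldType) (p s : nat) (A : {set 'F_p}) :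
  (J s A)%:R = energy R A s.
Proof.
rewrite /energy; under eq_bigr do rewrite -natrX.
rewrite -natr_sum; congr (_%:R).
rewrite /J -sum1_card; under eq_bigl do rewrite inE.
rewrite [LHS]big_mkcond (reindex (@ffun_cat 'F_p s s)) /=; last exact/onW_bij/ffun_cat_bij.
under [RHS]eq_bigr do rewrite expnS expn1 !repsE big_distrlr /=.
rewrite exchange_big /=; under [RHS]eq_bigr do rewrite exchange_big /=.
rewrite pair_big [RHS]big_mkcond /=; apply: eq_bigr => -[y z] _ /=.
rewrite (ffun_cat_forall (mem A)) -andbA.
under eq_bigr do rewrite ffun_cat_lshift ffun_cat_rshift.
under [X in _ && (_ && (X == 0))]eq_bigr do rewrite ffun_cat_lshift ffun_cat_rshift.
rewrite !sumrB !subr_eq0.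
rewrite andbA sum_eq_muln [in RHS]eq_sym !sum_parab xpair_eqE.
by rewrite [LHS]if_and; congr (if _ then _ else _).
Qed.

Lemma energy_le_expn (R : realFieldType) (F : finFieldType) (A : {set F}) n :
  energy R A n <= #|A|%:R ^+ (2 * n).
Proof.
rewrite mulnC exprM -natrX -(sum_reps A n) expr2 natr_sum mulr_suml.
apply: ler_sum => v _; rewrite expr2 ler_wpM2l // -natr_sum ler_nat.
by rewrite (bigD1 v) //= leq_addr.
Qed.

Lemma energy_bound (R : realFieldType) (p s : nat) (A : {set 'F_p}) :
  prime p -> (0 < #|A|)%N -> (2 <= s)%N ->
  energy R A s <= 4 ^+ s * (#|A|%:R ^+ (2 * s - 1) / p%:R
                            + #|A|%:R ^+ 2 * p%:R ^+ (s - 2)).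
Proof.
move=> p_pr A_gt0; case: s => [|[|n]] // _.
have [p2 | p_neq2] := eqVneq p 2%N; last first.
  have two_neq0 : (2 : 'F_p) != 0.
    by rewrite -(dvdn_pcharf (pchar_Fp p_pr)) dvdn_prime2.
  by have := energy_le R two_neq0 n A_gt0; rewrite card_Fp // subn2.
apply: le_trans (energy_le_expn R A n.+2) _.
have N_ge0 : 0 <= #|A|%:R :> R by [].
have A_le2 : #|A|%:R <= 2 :> R.
  by rewrite ler_nat -p2 -[leqRHS](card_Fp p_pr) max_card.
have -> : (2 * n.+2 = (2 * n.+2 - 1).+1)%N by lia.
rewrite subn1 /= exprS.
set M := #|A|%:R ^+ _; have M_ge0 : 0 <= M by rewrite exprn_ge0.
have C_ge4 : 4 <= 4 ^+ n.+2 :> R.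
  by rewrite exprS ler_peMr // exprn_ege1 // ler1n.
have -> : p%:R = 2 :> R by rewrite p2.
set Y := _ * 2 ^+ _; have Y_ge0 : 0 <= Y by rewrite mulr_ge0 ?exprn_ge0.
have : #|A|%:R * M <= 2 * M by rewrite ler_wpM2r.
have : 0 <= (4 ^+ n.+2 - 4) * (M / 2 + Y).
  by rewrite mulr_ge0 ?subr_ge0 // addr_ge0 // divr_ge0.
by lra.
Qed.

(* For #|A| = 1 the logarithm vanishes and the bound would read 1 <= C / p for
   every prime p, which no C satisfies; hence the hypothesis 1 < #|A|. *)
Theorem proposition1p2 (R : realType) (s : nat) (hs : (3 <= s)%N) :
  exists C : R, 0 < C /\
    forall (p : nat) (A : {set 'F_p}), prime p -> (1 < #|A|)%N ->
      (J s A)%:R <=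
        C * (#|A|%:R ^+ (2 * s - 1) / p%:R
             + #|A|%:R ^+ 2 * p%:R ^+ (s - 2) * ln (#|A|%:R) ^+ (2 * s)).
Proof.
set l : R := ln 2 ^+ (2 * s).
have l_gt0 : 0 < l by rewrite exprn_gt0 // ln_gt0 // ltr1n.
exists (4 ^+ s * (1 + l^-1)); split.
  by rewrite mulr_gt0 ?exprn_gt0 // addr_gt0 // invr_gt0.
move=> p A p_pr A_gt1; rewrite J_energy.
apply: le_trans (energy_bound R p_pr (ltnW A_gt1) (ltnW hs)) _.
rewrite -[leRHS]mulrA ler_pM2l ?exprn_gt0 //.
set X := _ / _; set Y := _ * p%:R ^+ _; set L := ln _ ^+ _.
have X_ge0 : 0 <= X by rewrite divr_ge0 ?exprn_ge0.
have Y_ge0 : 0 <= Y by rewrite mulr_ge0 ?exprn_ge0.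
have lL : l <= L.
  rewrite lerXn2r ?nnegrE ?ln_ge0 ?ler1n ?(ltnW A_gt1) //.
  by rewrite ler_ln ?posrE ?ler_nat ?ltr0n ?(ltnW A_gt1).
have L_ge1 : 1 <= l^-1 * L by rewrite mulrC ler_pdivlMr // mul1r.
have : 0 <= l^-1 * X by rewrite mulr_ge0 // invr_ge0 ltW.
have : 0 <= L * Y by rewrite mulr_ge0 // (le_trans (ltW l_gt0)).
have : Y <= Y * (l^-1 * L) by rewrite ler_peMr.
by nra.
Qed.
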